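(* Let $P_0,P_1,P_2$ be three non-collinear points of $\mathbb{RP}^2$. Then the right-spherical billiard $\mathcal{S}(P_0,P_1,P_2)$ is $3$-reflective.
   Context: All objects live in the real projective plane $\mathbb{RP}^2$ (containing $\mathbb{R}^2$ as an affine chart). Projective reflection law: let $p$ be a point and let $T\neq L$ be two lines through $p$ ($T$ is the edge, $L$ the transverse line at $p$). A line $\ell$ through $p$ is reflected into the line $\ell'$ through $p$ if $(\ell,\ell',L,T)$ is harmonic, i.e. has cross-ratio $-1$ (the cross-ratio of four lines through $p$ is the cross-ratio of their intersection points with any fifth line not passing through $p$). Equivalently, $\ell\mapsto \ell'$ is the non-trivial projective involution of the pencil of lines through $p$ fixing $L$ and $T$ (so $L$ and $T$ are reflected into themselves). Polygonal projective billiard: a polygon with vertices $P_0,\dots,P_{n-1}$ (indices modulo $n$), whose edges are the whole lines $\gamma_k=P_kP_{k+1}$, each edge being endowed with a field of transverse lines $M\mapsto L_k(M)\ni M$ for $M\in\gamma_k$. Orbit: for distinct points $M_0\in P_0P_1$, $M_1\in P_1P_2$, the orbit of $(M_0,M_1)$ is the sequence $(M_k)_{k\in\mathbb{Z}}$ with $M_k\in P_kP_{k+1}$ (indices of $P$ modulo $n$) such that for each $k$ the line $M_{k-1}M_k$ is reflected into the line $M_kM_{k+1}$ by the projective reflection law at $M_k$ with edge $\gamma_k$ and transverse line $L_k(M_k)$. Obstacles between consecutive edges are ignored. For $m$ a positive multiple of $n$, the orbit is $m$-periodic if the lines $M_mM_{m+1}$ and $M_0M_1$ coincide. The billiard is $m$-reflective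 if there is a non-empty open subset $U\times V\subset P_0P_1\times P_1P_2$ such that the orbit of every $(M_0,M_1)\in U\times V$ is $m$-periodic. Right-spherical billiard $\mathcal{S}(P_0,P_1,P_2)$: the polygonal projective billiard on the triangle $P_0P_1P_2$ ($n=3$, indices modulo $3$) in which the transverse line at $M\in\gamma_i=P_iP_{i+1}$ is $L_i(M)=MP_{i+2}$, the line joining $M$ to the vertex that does not lie on $\gamma_i$. *)

(* Defs.v *)
From HB Require Import structures.
From mathcomp Require Import all_boot all_order all_algebra.
From mathcomp Require Import all_classical all_reals all_analysis.
Set Implicit Arguments.
Unset Strict Implicit.
Unset Printing Implicit Defensive.
Import Order.TTheory GRing.Theory Num.Theory.
Import numFieldNormedType.Exports.
Local Open Scope classical_set_scope.
Local Open Scope ring_scope.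

(* Points of the real projective plane are the lines of R^3 through the origin;
   projective lines are its planes through the origin.  Incidence is inclusion
   of subspaces, the line joining two distinct points is their sum, and the
   intersection point of two distinct lines is their intersection. *)
Record RP2 (R : realType) := MkRP2 {
  rp_space :> {vspace 'rV[R]_3};
  _ : \dim rp_space == 1%N }.

HB.instance Definition _ (R : realType) := [isSub for @rp_space R].
HB.instance Definition _ (R : realType) := [Choice of RP2 R by <:].

Section QuotientTopology.
Variable R : realType.

(* The topology of RP2 is the quotient topology of R^3 minus the origin: a set
   of points is open when the set of its nonzero representatives is (the
   vectors v below are automatically nonzero). *)
Definition RP2_open (U : set (RP2 R)) : Prop :=
  open [set v : 'rV[R]_3 | exists2 p : RP2 R, U p & rp_space p = <[v]>%VS].

Lemma RP2_dim (p : RP2 R) : \dim p = 1%N.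
Proof. by case: p => p /= /eqP. Qed.

Lemma RP2_openT : RP2_open setT.
Proof.
rewrite /RP2_open.
have -> : [set v : 'rV[R]_3 | exists2 p : RP2 R, setT p & rp_space p = <[v]>%VS]
        = ~` [set 0].
  apply/seteqP; split => v /=.
    move=> [p _ pv] v0; have := RP2_dim p.
    by rewrite pv v0 dim_vline eqxx.
  move=> /eqP v0.
  have dv : \dim <[v]> == 1%N by rewrite dim_vline v0.
  by exists (MkRP2 dv).
by rewrite openC; apply: accessible_closed_set1; apply: hausdorff_accessible;
  exact: norm_hausdorff.
Qed.

Lemma RP2_openI : setI_closed RP2_open.
Proof.
move=> A B oA oB; rewrite /RP2_open.
have := openI oA oB; congr open; apply/seteqP; split => v /=.
  move=> [[p Ap pv] [q Bq qv]]; exists p => //; split => //.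
  by have -> : p = q by apply: val_inj; rewrite /= pv qv.
by move=> [p [Ap Bp] pv]; split; exists p.
Qed.

Lemma RP2_open_bigcup (I : Type) (f : I -> set (RP2 R)) :
  (forall i, RP2_open (f i)) -> RP2_open (\bigcup_i f i).
Proof.
move=> of_; rewrite /RP2_open.
have := @bigcup_open _ _ setT _ (fun i _ => of_ i).
congr open; apply/seteqP; split => v /=.
  by move=> [i _ [p fp pv]]; exists p => //; exists i.
by move=> [p [i _ fp] pv]; exists i => //; exists p.
Qed.

HB.instance Definition _ :=
  isOpenTopological.Build (RP2 R) RP2_openT RP2_openI RP2_open_bigcup.

End QuotientTopology.

Section Projective.
Variable R : realType.
Implicit Types (p q r M : RP2 R) (A B C D l d T L : {vspace 'rV[R]_3}).

Definition is_line l : Prop := \dim l = 2%N.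

Definition join p q : {vspace 'rV[R]_3} := (p + q)%VS.

Definition incident p l : bool := (rp_space p <= l)%VS.

Definition points_of l : set (RP2 R) := [set p | incident p l].

Definition collinear p q r : Prop :=
  exists l, [/\ is_line l, incident p l, incident q l & incident r l].

(* (A, B; C, D) = k for collinear points: for homogeneous coordinates a, b of A, B
   normalised so that a + b represents C, the point D is represented by
   k a + b.  With [x, y] the determinant in a basis of the underlying plane, this
   is k = [a, c] [b, d] / ([a, d] [b, c]). *)
Definition has_cross_ratio A B C D (k : R) : Prop :=
  exists a b : 'rV[R]_3,
    free [:: a; b] /\
    [/\ A = <[a]>%VS, B = <[b]>%VS, C = <[a + b]>%VS & D = <[k *: a + b]>%VS].

Definition lines_cross_ratio p (l l' m m' : {vspace 'rV[R]_3}) (k : R) : Prop :=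
  [/\ is_line l, is_line l', is_line m & is_line m'] /\
  [/\ incident p l, incident p l', incident p m & incident p m'] /\
  forall d, is_line d -> ~~ incident p d ->
    has_cross_ratio (l :&: d) (l' :&: d) (m :&: d) (m' :&: d) k.

(* A cross-ratio of -1 forces l, l', L, T to be pairwise distinct; the first
   two cases are the fixed lines L and T of the harmonic involution. *)
Definition reflected p T L l l' : Prop :=
  [\/ l = L /\ l' = L, l = T /\ l' = T | lines_cross_ratio p l l' L T (-1)].

(* 'Z_n is the ring of integers modulo n only for n > 1. *)
Record billiard (n : nat) := Billiard {
  vertex : 'Z_n -> RP2 R;
  transverse : 'Z_n -> RP2 R -> {vspace 'rV[R]_3};
  billiard_size : (2 < n)%N;
  vertex_neq : forall i, vertex i <> vertex (i + 1);
  transverse_line : forall i M, incident M (join (vertex i) (vertex (i + 1))) ->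
    [/\ is_line (transverse i M), incident M (transverse i M) &
        transverse i M <> join (vertex i) (vertex (i + 1))] }.

Definition edge n (B : billiard n) (i : 'Z_n) : {vspace 'rV[R]_3} :=
  join (vertex B i) (vertex B (i + 1)).

(* The conditions M k <> M (k + 1) make the lines M_k M_{k+1} meaningful. *)
Definition is_orbit n (B : billiard n) (M : int -> RP2 R) : Prop :=
  forall k : int,
    [/\ incident (M k) (edge B k%:~R), M k <> M (k + 1) &
        reflected (M k) (edge B k%:~R) (transverse B k%:~R (M k))
                  (join (M (k - 1)) (M k)) (join (M k) (M (k + 1)))].

Definition orbit_from n (B : billiard n) M0 M1 (M : int -> RP2 R) : Prop :=
  [/\ is_orbit B M, M 0 = M0 & M 1 = M1].

Definition periodic (m : nat) (M : int -> RP2 R) : Prop :=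
  join (M m%:Z) (M (m%:Z + 1)) = join (M 0) (M 1).

(* Speaking of "the" orbit of (M0, M1) includes its existence and uniqueness. *)
Definition reflective n (B : billiard n) (m : nat) : Prop :=
  [/\ (0 < m)%N, (n %| m)%N &
  exists U V : set (RP2 R),
    [/\ U !=set0, V !=set0,
        U `<=` points_of (edge B 0) /\
          open (U : set (subspace (points_of (edge B 0)))),
        V `<=` points_of (edge B 1) /\
          open (V : set (subspace (points_of (edge B 1)))) &
        forall M0 M1, U M0 -> V M1 ->
          exists M : int -> RP2 R, unique (orbit_from B M0 M1) M /\ periodic m M]].

Lemma join_dim p q : p <> q -> is_line (join p q).
Proof.
move=> pq; rewrite /is_line /join dimv_disjoint_sum ?RP2_dim //.
apply/eqP; rewrite -dimv_eq0; apply/negPn/negP => d0; apply: pq.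
have capl : (p :&: q <= p)%VS by apply: capvSl.
have capr : (p :&: q <= q)%VS by apply: capvSr.
apply: val_inj => /=.
have /eqP <- : (p :&: q == p)%VS by rewrite eqEdim capl RP2_dim lt0n.
by apply/eqP; rewrite eqEdim capr RP2_dim lt0n.
Qed.

Definition triangle p q r (i : 'Z_3) : RP2 R := tnth [tuple p; q; r] i.

Lemma triangle_noncollinear p q r : ~ collinear p q r -> forall i : 'Z_3,
  ~ collinear (triangle p q r i) (triangle p q r (i + 1)) (triangle p q r (i + 2)).
Proof.
move=> npqr [[|[|[|//]]] i]; rewrite /triangle !(tnth_nth p) /= => -[l [? ? ? ?]];
  by apply: npqr; exists l.
Qed.

Lemma exists_line_through p q : exists l, [/\ is_line l, incident p l & incident q l].
Proof.
have [<-|/eqP pq] := eqVneq p q; last first.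
  exists (join p q); split; [exact: join_dim|exact: addvSl|exact: addvSr].
have [v vp] : exists v, v \notin rp_space p.
  have : ~~ (fullv <= rp_space p)%VS.
    by apply/negP => /dimvS; rewrite RP2_dim dimvf /dim /=.
  by case/subvPn => v _ vp; exists v.
have v0 : v != 0 by apply: contraNneq vp => ->; exact: mem0v.
have dv : \dim <[v]> == 1%N by rewrite dim_vline v0.
have pv : p <> MkRP2 dv.
  by move=> e; move: vp; rewrite e /= memv_line.
by exists (join p (MkRP2 dv)); split; [exact: join_dim|exact: addvSl|exact: addvSl].
Qed.

Lemma noncollinear_neq p q r : ~ collinear p q r -> p <> q.
Proof.
move=> npqr pq; apply: npqr; have [l [? ? ?]] := exists_line_through p r.
by exists l; split => //; rewrite -pq.
Qed.

Lemma noncollinear_off_edge p q r : ~ collinear p q r -> ~~ incident r (join p q).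
Proof.
move=> npqr; have pq := noncollinear_neq npqr.
apply/negP => rpq; apply: npqr; exists (join p q).
split=> //; [|exact: addvSl|exact: addvSr].
exact: join_dim.
Qed.

Section RightSpherical.
Variables (P0 P1 P2 : RP2 R) (nP : ~ collinear P0 P1 P2).
Let P := triangle P0 P1 P2.

Definition right_spherical_transverse (i : 'Z_3) M := join M (P (i + 2)).

Lemma right_spherical_vertex_neq i : P i <> P (i + 1).
Proof. exact: (noncollinear_neq (triangle_noncollinear (i := i) nP)). Qed.

Lemma right_spherical_transverse_line i M : incident M (join (P i) (P (i + 1))) ->
  [/\ is_line (right_spherical_transverse i M),
      incident M (right_spherical_transverse i M) &
      right_spherical_transverse i M <> join (P i) (P (i + 1))].
Proof.
move=> Me; have off := noncollinear_off_edge (triangle_noncollinear (i := i) nP).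
split.
- by apply: join_dim => MP; move/negP: off; apply; rewrite -/(P _) -MP.
- exact: addvSl.
- by move=> e; move/negP: off; apply; rewrite -/(P _) -/(P _) -e; exact: addvSr.
Qed.

Definition right_spherical : billiard 3 :=
  Billiard (transverse := right_spherical_transverse) (isT : (2 < 3)%N)
    right_spherical_vertex_neq right_spherical_transverse_line.

End RightSpherical.
End Projective.

(* Main.v *)
(* Choose vectors e 0, e 1, e 2 representing the vertices.  If M0 and M1 are not
   vertices, these can be rescaled so that M0 = <e 0 + e 1> and
   M1 = <e 1 + e 2>.  At M1 the transverse line and the edge meet the line P0P1
   in <e 0> and <e 1>, so the reflection exchanges <e 0 + e 1> and <e 0 - e 1>
   there, and (e 1 + e 2) + (e 0 - e 1) = e 2 + e 0 shows that M2 = <e 2 + e 0>.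
   By cyclic symmetry M_k = <e k + e (k + 1)> with indices modulo 3. *)
Require Import Defs.
From mathcomp Require Import all_boot all_order all_algebra.
From mathcomp Require Import all_classical all_reals all_analysis.
From mathcomp Require Import ring lra.
Set Implicit Arguments.
Unset Strict Implicit.
Unset Printing Implicit Defensive.
Import Order.TTheory GRing.Theory Num.Theory.
Import numFieldNormedType.Exports.
Local Open Scope classical_set_scope.
Local Open Scope ring_scope.

(** * Linear algebra of pencils of lines and of the harmonic reflection *)

Section Spans.
Variable R : realType.
Implicit Types (m u v w x y z : 'rV[R]_3) (U d l : {vspace 'rV[R]_3}).

Lemma memv_add_linesP w x y :
  reflect (exists a b, w = a *: x + b *: y) (w \in <[x]> + <[y]>)%VS.
Proof.
apply: (iffP memv_addP) => [[_ /vlineP[a ->] [_ /vlineP[b ->] ->]]|[a [b ->]]].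
  by exists a, b.
by exists (a *: x); rewrite ?memvZ ?memv_line//; exists (b *: y);
  rewrite ?memvZ ?memv_line.
Qed.

Lemma free3_eq0 x y z a b c : free [:: x; y; z] ->
  a *: x + b *: y + c *: z = 0 -> [/\ a = 0, b = 0 & c = 0].
Proof.
move=> /(@freeP _ _ _ [tuple x; y; z]) f e.
pose k (i : 'I_3) := [tuple a; b; c]`_i.
have {}f : forall i, k i = 0 by apply: f; rewrite !big_ord_recl big_ord0 addr0 addrA.
by split; [exact: (f 0)|exact: (f 1)|exact: (f 2)].
Qed.

Lemma free2P x y :
  (forall a b, a *: x + b *: y = 0 -> a = 0 /\ b = 0) -> free [:: x; y].
Proof.
move=> f; apply/(@freeP _ _ _ [tuple x; y]) => k.
rewrite !big_ord_recl big_ord0 addr0 => /f[k0 k1] [[|[|//]] i].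
  by rewrite -k0; congr k; apply: val_inj.
by rewrite -k1; congr k; apply: val_inj.
Qed.

Lemma free3P x y z :
  (forall a b c, a *: x + b *: y + c *: z = 0 -> [/\ a = 0, b = 0 & c = 0]) ->
  free [:: x; y; z].
Proof.
move=> f; apply/(@freeP _ _ _ [tuple x; y; z]) => k.
rewrite !big_ord_recl big_ord0 addr0 addrA => /f[k0 k1 k2] [[|[|[|//]]] i].
- by rewrite -k0; congr k; apply: val_inj.
- by rewrite -k1; congr k; apply: val_inj.
- by rewrite -k2; congr k; apply: val_inj.
Qed.

Lemma dim_add_lines x y : free [:: x; y] -> is_line (<[x]> + <[y]>)%VS.
Proof. by rewrite /is_line -[(<[y]>)%VS]span_seq1 -span_cons => /eqP ->. Qed.

(** A line through [<[m]>] depends on its second generator only modulo [m], so a pencil can be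
    computed in the quotient by [m]. *)
Lemma add_lines_shift m u (s : R) : (<[m]> + <[u + s *: m]> = <[m]> + <[u]>)%VS.
Proof.
apply/eqP; rewrite eqEsubv !subv_add !addvSl /= -!memvE.
apply/andP; split; apply/memv_add_linesP.
  by exists s, 1; rewrite scale1r addrC.
by exists (- s), 1; rewrite scale1r scaleNr addrC addrK.
Qed.

Lemma add_lines_suml u v : (<[u + v]> + <[u]> = <[u]> + <[v]>)%VS.
Proof. by rewrite addvC addrC -(add_lines_shift u v 1) scale1r. Qed.

Lemma line_scale u (s : R) : s != 0 -> (<[s *: u]> = <[u]>)%VS.
Proof.
move=> s0; apply/eqP; rewrite eqEsubv -!memvE memvZ ?memv_line//=.
by apply/vlineP; exists s^-1; rewrite scalerA mulVf // scale1r.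
Qed.

Lemma line_cap0 m d : m \notin d -> (<[m]> :&: d = 0)%VS.
Proof.
move=> md; apply/eqP; rewrite -subv0; apply/subvP => w.
rewrite memv_cap memv0 => /andP[/vlineP[k ->] kd].
have [->|k0] := eqVneq k 0; first by rewrite scale0r.
by move: md; rewrite -(scale1r m) -(mulVf k0) -scalerA memvZ.
Qed.

Lemma pencil_cap m u d : m \notin d -> u \in d ->
  ((<[m]> + <[u]>) :&: d = <[u]>)%VS.
Proof.
by move=> md ud; rewrite addvC -vspace_modl -?memvE// line_cap0// addv0.
Qed.

(** The plane [d] misses [m], hence is a complement of [<[m]>]; the vector found is the projection
    of [u] to [d] along [m]. *)
Lemma pencil_proj m u d : is_line d -> m \notin d -> exists s, u + s *: m \in d.
Proof.
move=> dl md.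
have dm : (d + <[m]> = fullv)%VS.
  apply/eqP; rewrite eqEdim subvf /= dimv_disjoint_sum; last first.
    by rewrite capvC line_cap0.
  have m0 : m != 0 by apply: contraNneq md => ->; exact: mem0v.
  by rewrite dl dim_vline m0 dimvf.
have : u \in (d + <[m]>)%VS by rewrite dm memvf.
case/memv_addP => w wd [_ /vlineP[s ->] ->]; exists (- s).
by rewrite scaleNr addrK.
Qed.

(** For any [d], shift [u] and [w] by multiples of [m] to a, b in [d]. The four lines meet [d] in
    the spans of a, b, a + b and b - a, the normal form of cross-ratio -1. *)
Lemma harmonic_pencil (p : RP2 R) m u w :
  free [:: m; u; w] -> rp_space p = <[m]>%VS ->
  lines_cross_ratio p (<[m]> + <[u]>) (<[m]> + <[w]>)
    (<[m]> + <[u + w]>) (<[m]> + <[w - u]>) (-1).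
Proof.
move=> f pm.
(* Any non-zero combination of [u] and [w] is independent of [m], so the four spans really are
   lines. *)
have f2 v a b : v = a *: u + b *: w -> (a != 0) || (b != 0) -> free [:: m; v].
  move=> -> ab; apply: free2P => s t e.
  have [-> ta tb] : [/\ s = 0, t * a = 0 & t * b = 0].
    by apply: (free3_eq0 f); rewrite -e scalerDr !scalerA addrA.
  split=> //; case/orP: ab => [a0|b0].
    by apply: (mulIf a0); rewrite ta mul0r.
  by apply: (mulIf b0); rewrite tb mul0r.
have fu : free [:: m; u] by apply: (f2 _ 1 0); rewrite ?scale1r ?scale0r ?addr0 ?oner_eq0.
have fw : free [:: m; w].
  by apply: (f2 _ 0 1); rewrite ?scale1r ?scale0r ?add0r ?oner_eq0 ?orbT.
have fL : free [:: m; u + w] by apply: (f2 _ 1 1); rewrite ?scale1r ?oner_eq0.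
have fT : free [:: m; w - u].
  by apply: (f2 _ (-1) 1); rewrite ?scaleN1r ?scale1r ?oner_eq0 ?orbT // addrC.
split; first by split; apply: dim_add_lines.
rewrite /incident pm; split; first by split; apply: addvSl.
move=> d dl md; rewrite -memvE in md.
have [s ud] := pencil_proj u dl md; have [t wd] := pencil_proj w dl md.
exists (u + s *: m), (w + t *: m); split.
  apply: free2P => a b e.
  have [] // := @free3_eq0 m u w (a * s + b * t) a b f.
  rewrite -[RHS]e; apply/rowP => i; rewrite !mxE; ring.
split.
- by rewrite -(add_lines_shift m u s) pencil_cap.
- by rewrite -(add_lines_shift m w t) pencil_cap.
- rewrite -(add_lines_shift m (u + w) (s + t)).
  have -> : u + w + (s + t) *: m = u + s *: m + (w + t *: m).
    by apply/rowP => i; rewrite !mxE; ring.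
  by rewrite pencil_cap // memvD.
- rewrite -(add_lines_shift m (w - u) (t - s)).
  have -> : w - u + (t - s) *: m = -1 *: (u + s *: m) + (w + t *: m).
    by apply/rowP => i; rewrite !mxE; ring.
  by rewrite pencil_cap // memvD // memvZ.
Qed.

(* Modulo m = y + z the lines l, l', L, T are spanned by x + y, x - y, x and y. *)
Lemma reflected_basis (p : RP2 R) x y z : free [:: x; y; z] ->
  rp_space p = <[y + z]>%VS ->
  reflected p (<[y]> + <[z]>) (<[y + z]> + <[x]>)
    (<[x + y]> + <[y + z]>) (<[y + z]> + <[z + x]>).
Proof.
move=> f pm; apply: Or33.
(* Apply [harmonic_pencil] with u = x + y and w = x - y: then u + w = 2x, w - u = -2y, and w + m = z
   + x. *)
have fm : free [:: y + z; x + y; x - y].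
  apply: free3P => a b c e.
  have [|bc abc a0] := @free3_eq0 x y z (b + c) (a + b - c) a f.
    by rewrite -[RHS]e; apply/rowP => i; rewrite !mxE; ring.
  by split; lra.
have := harmonic_pencil fm pm; rewrite [X in lines_cross_ratio _ X]addvC.
have -> : (<[y + z]> + <[x - y]> = <[y + z]> + <[z + x]>)%VS.
  rewrite -(add_lines_shift _ (x - y) 1).
  suff -> : x - y + 1 *: (y + z) = z + x by [].
  by apply/rowP => i; rewrite !mxE; ring.
have -> : x + y + (x - y) = 2 *: x by apply/rowP => i; rewrite !mxE; ring.
have -> : x - y - (x + y) = -2 *: y by apply/rowP => i; rewrite !mxE; ring.
rewrite !line_scale ?oppr_eq0 ?pnatr_eq0 //.
by rewrite add_lines_suml.
Qed.

(** Exchanging [a] and [b] preserves a + b and changes b - a only by a sign: -1 is its own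
    inverse. *)
Lemma reflected_sym (p : RP2 R) T L l l' : reflected p T L l l' -> reflected p T L l' l.
Proof.
case=> [[-> ->]|[-> ->]|[[lT l'T LT TT] [[pl pl' pL pT] h]]]; [exact: Or31|exact: Or32|].
apply: Or33; split; first by split.
split; first by split.
move=> d dl pd; have [a [b [f [la lb lL lT']]]] := h d dl pd.
exists b, a; split.
  by rewrite (@perm_free _ _ _ [:: a; b]) // (perm_catC [:: b]).
split=> //; first by rewrite addrC.
rewrite lT' -(@line_scale (-1 *: b + a) (-1)) ?oppr_eq0 ?oner_eq0 //; congr <[_]>%VS.
by apply/rowP => i; rewrite !mxE; ring.
Qed.

(* The fixed lines L and T of the reflection do not contain x + y, so the
   reflection is harmonic; cutting with the line <x, y> then shows that the
   reflected line contains x - y, hence z + x. *)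
Lemma reflected_basis_inj (p q : RP2 R) x y z : free [:: x; y; z] ->
  rp_space p = <[y + z]>%VS -> (q <= <[z]> + <[x]>)%VS ->
  reflected p (<[y]> + <[z]>) (<[y + z]> + <[x]>)
    (<[x + y]> + <[y + z]>) (join p q) ->
  rp_space q = <[z + x]>%VS.
Proof.
move=> f pm qe h.
have nT : y + z \notin (<[z]> + <[x]>)%VS.
  apply/negP => /memv_add_linesP[a [b e]].
  have [] := @free3_eq0 x y z (- b) 1 (1 - a) f; last by lra.
  by move/rowP: e => e; apply/rowP => i; have := e i; rewrite !mxE; lra.
(* By the modular law, the line [join p q] meets the line <z, x> only in [q], because [p] is off
   that line. *)
suff h' : z + x \in join p q.
  have : z + x \in (join p q :&: (<[z]> + <[x]>))%VS.
    by rewrite memv_cap h' memv_add ?memv_line.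
  rewrite /join addvC -vspace_modl // pm line_cap0 // addv0 memvE => zxq.
  apply/eqP; rewrite eq_sym eqEdim zxq RP2_dim dim_vline.
  have : free [:: z + x; x].
    apply: free2P => a b e.
    have [] := @free3_eq0 x y z (a + b) 0 a f; last by split; lra.
    by rewrite -[RHS]e; apply/rowP => i; rewrite !mxE; ring.
  by case: eqVneq => // ->; rewrite free_cons mem0v.
have xyl : x + y \in (<[x + y]> + <[y + z]>)%VS by rewrite memvE addvSl.
case: h => [[e _]|[e _]|[_ [_ h]]].
- move: xyl; rewrite e => /memv_add_linesP[a [b]] {}e.
  have [] := @free3_eq0 x y z (1 - b) (1 - a) (- a) f; last by lra.
  by move/rowP: e => e; apply/rowP => i; have := e i; rewrite !mxE; lra.
- move: xyl; rewrite e => /memv_add_linesP[a [b]] {}e.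
  have [] := @free3_eq0 x y z 1 (1 - a) (- b) f; last by lra.
  by move/rowP: e => e; apply/rowP => i; have := e i; rewrite !mxE; lra.
have fxy : free [:: x; y].
  apply: free2P => a b e.
  by have [] := @free3_eq0 x y z a b 0 f; first by rewrite scale0r addr0.
have md : y + z \notin (<[x]> + <[y]>)%VS.
  apply/negP => /memv_add_linesP[a [b e]].
  have [] := @free3_eq0 x y z (- a) (1 - b) 1 f; last by lra.
  by move/rowP: e => e; apply/rowP => i; have := e i; rewrite !mxE; lra.
have := h _ (dim_add_lines fxy); rewrite /incident pm -memvE md => /(_ isT).
case=> a [b [fab []]].
rewrite (addvC <[x + y]>%VS) -(add_lines_suml y z).
have xd : x \in (<[x]> + <[y]>)%VS by rewrite memvE addvSl.
have yd : y \in (<[x]> + <[y]>)%VS by rewrite memvE addvSr.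
rewrite (pencil_cap md (memvD xd yd)) (pencil_cap md xd) (pencil_cap md yd).
move=> la lb lc lt.
(* Writing 2a = (a + b) - (b - a) gives 2s(x + y) = tx - ry, so t = 2s and b = s(x - y). Freeness of
   [a], [b] makes s non-zero. *)
have /vlineP[s sa] : a \in <[x + y]>%VS by rewrite la memv_line.
have /vlineP[t tc] : a + b \in <[x]>%VS by rewrite lc memv_line.
have /vlineP[r rt] : -1 *: a + b \in <[y]>%VS by rewrite lt memv_line.
have [st sr _] : [/\ 2 * s - t = 0, 2 * s + r = 0 & 0 = 0 :> R].
  apply: (free3_eq0 f); move/rowP: sa => sa; move/rowP: tc => tc.
  move/rowP: rt => rt; apply/rowP => i; have := sa i; have := tc i; have := rt i.
  by rewrite !mxE; lra.
have s0 : s != 0.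
  by move: fab; case: eqVneq sa => // -> ->; rewrite scale0r => /free_not0; move=> /(_ 0); rewrite mem_head eqxx => /(_ isT).
have -> : z + x = (y + z) + s^-1 *: b.
  apply: (scalerI s0); rewrite [RHS]scalerDr scalerA mulfV // scale1r.
  by move/rowP: sa => sa; move/rowP: tc => tc; apply/rowP => i;
    have := sa i; have := tc i; rewrite !mxE; nra.
apply: memvD; first by rewrite memvE -pm addvSl.
by apply: memvZ; have : b \in <[b]>%VS := memv_line b; rewrite -lb memv_cap => /andP[].
Qed.

End Spans.

(** * Representing vectors, and the topology of points off a line *)

Section Orbits.
Variable R : realType.
Implicit Types (p q : RP2 R) (l : {vspace 'rV[R]_3}) (v : 'rV[R]_3).

Lemma RP2_vline p : exists v, rp_space p = <[v]>%VS.
Proof.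
have p0 : vpick p != 0 by rewrite vpick0 -dimv_eq0 RP2_dim.
exists (vpick p); apply/eqP.
by rewrite eq_sym eqEdim -memvE memv_pick dim_vline p0 RP2_dim.
Qed.

Lemma exists_RP2 v : v != 0 -> exists p, rp_space p = <[v]>%VS.
Proof.
move=> v0; have dv : \dim <[v]> == 1%N by rewrite dim_vline v0.
by exists (MkRP2 dv).
Qed.

(** The subspace is the common zero set of the coordinates of [v - projv l v], which are linear
    forms in the entries of [v], hence continuous. *)
Lemma closed_vspace l : closed [set v : 'rV[R]_3 | v \in l].
Proof.
pose f (i j : 'I_3) : R := (delta_mx 0 j - projv l (delta_mx 0 j)) 0 i.
have fE v i : (v - projv l v) 0 i = \sum_j v 0 j * f i j.
  rewrite {1 2}(row_sum_delta v) linear_sum -sumrB summxE.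
  by apply: eq_bigr => j _; rewrite linearZ -scalerBr mxE.
have -> : [set v : 'rV[R]_3 | v \in l] =
    \bigcap_(i : 'I_3) [set v : 'rV[R]_3 | \sum_j v 0 j * f i j = 0].
  apply/seteqP; split => v /= h.
    by move=> i _ /=; rewrite -fE projv_id // subrr mxE.
  suff : v - projv l v = 0 by move/eqP; rewrite subr_eq0 => /eqP ->; exact: memv_proj.
  by apply/rowP => i; rewrite fE mxE; exact: h.
apply: closed_bigI => i _.
apply: (@preimage_closed _ _ (fun v : 'rV[R]_3 => \sum_j v 0 j * f i j) [set 0]).
  move=> v _; under eq_fun do rewrite !big_ord_recl big_ord0 addr0.
  have c j : {for v, continuous (fun u : 'rV[R]_3 => u 0 j * f i j)}.
    by apply: continuousM; [exact: coord_continuous|exact: cst_continuous].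
  exact: (continuousD (c _) (continuousD (c _) (c _))).
by apply: accessible_closed_set1; apply: hausdorff_accessible; exact: norm_hausdorff.
Qed.

(** In the quotient topology this is openness of the complement of a subspace; that complement omits
    0 automatically. *)
Lemma open_off_line l : open [set p : RP2 R | ~~ incident p l].
Proof.
have := @closed_vspace l; rewrite -openC; congr open; apply/seteqP; split => v /=.
  move=> /negP vl; have [|p pv] := @exists_RP2 v.
    by apply: contraNneq vl => ->; exact: mem0v.
  by exists p => //; rewrite /incident pv -memvE.
by move=> [p + pv]; rewrite /incident pv -memvE => /negP.
Qed.

Lemma Z3_sub1 (i : 'Z_3) : i - 1 = i + 2.
Proof. by apply: val_inj; case: i => -[|[|[|//]]]. Qed.

Lemma Z3_add21 (i : 'Z_3) : i + 2 + 1 = i.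
Proof. by apply: val_inj; case: i => -[|[|[|//]]]. Qed.

(** * Orbits in coordinates adapted to the vertices *)

Section RightSphericalBasis.
Variables (P0 P1 P2 : RP2 R) (nP : ~ collinear P0 P1 P2) (e : 'Z_3 -> 'rV[R]_3).
Let P := triangle P0 P1 P2.
Let B := right_spherical nP.
Hypothesis eP : forall i, rp_space (P i) = <[e i]>%VS.

(** The opposite vertex is off the edge and the two ends of the edge differ. The order is that of x,
    y, z in [reflected_basis] at edge [i]. *)
Lemma free_rot i : free [:: e (i + 2); e i; e (i + 1)].
Proof.
rewrite !free_cons !span_cons span_nil !addv0 nil_free andbT memv0.
have := noncollinear_off_edge (triangle_noncollinear (i := i) nP).
rewrite /incident /join !eP -memvE => -> /=.
apply/andP; split; last first.
  by move: (RP2_dim (P (i + 1))); rewrite eP dim_vline; case: eqP.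
apply/negP; rewrite memvE -!eP => le.
apply: (right_spherical_vertex_neq (i := i) nP); apply: val_inj => /=.
by apply/eqP; rewrite eqEdim !RP2_dim le.
Qed.

Lemma edgeE i : edge B i = (<[e i]> + <[e (i + 1)%R]>)%VS.
Proof. by rewrite -!eP. Qed.

Lemma transverseE i p : transverse B i p = (p + <[e (i + 2)%R]>)%VS.
Proof. by rewrite -!eP. Qed.

(** With x, y, z the vectors at k + 2, k, k + 1, the points of indices k - 1, k, k + 1 are x + y, y
    + z, z + x, as in [reflected_basis]. *)
Lemma midpoints_orbit (M : int -> RP2 R) :
  (forall k, rp_space (M k) = <[e k%:~R + e (k%:~R + 1)%R]>%VS) -> is_orbit B M.
Proof.
move=> ME k; have f := free_rot k%:~R.
have Mn : rp_space (M (k + 1)) = <[e (k%:~R + 1)%R + e (k%:~R + 2)%R]>%VS.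
  by rewrite ME intrD -addrA.
have Mp : rp_space (M (k - 1)) = <[e (k%:~R + 2)%R + e k%:~R]>%VS.
  by rewrite ME intrB Z3_sub1 Z3_add21.
split.
- by rewrite /incident edgeE ME -memvE memv_add ?memv_line.
- move=> Mk; have : e k%:~R + e (k%:~R + 1) \in <[e (k%:~R + 1)%R + e (k%:~R + 2)%R]>%VS.
    by rewrite -Mn -Mk ME memv_line.
  case/vlineP => a /rowP E.
  have [|] := @free3_eq0 _ _ _ _ (- a) 1 (1 - a) f; last by lra.
  by apply/rowP => i; have := E i; rewrite !mxE; lra.
- rewrite edgeE transverseE /join ME Mn Mp.
  exact: reflected_basis.
Qed.

(** This gives uniqueness of the orbit: by [reflected_basis_inj], two consecutive points force the
    next one and the previous one. *)
Lemma orbit_midpoints (M : int -> RP2 R) : is_orbit B M ->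
  rp_space (M 0) = <[e 0%R + e 1%R]>%VS -> rp_space (M 1) = <[e 1%R + e 2%R]>%VS ->
  forall k, rp_space (M k) = <[e k%:~R + e (k%:~R + 1)%R]>%VS.
Proof.
move=> orb M0 M1; pose C k := rp_space (M k) = <[e k%:~R + e (k%:~R + 1)%R]>%VS.
have fwd k : C (k - 1) -> C k -> C (k + 1).
  rewrite /C intrB intrD Z3_sub1 Z3_add21 -addrA => Mp ME.
  have [_ _] := orb k; rewrite edgeE transverseE [join (M (k - 1)) _]/join Mp ME.
  apply: reflected_basis_inj => //; first exact: free_rot.
  have [+ _ _] := orb (k + 1); rewrite /incident edgeE intrD -addrA.
  by [].
(* Reflection is symmetric, so this is a forward step with the last two basis
   vectors exchanged. *)
have bwd k : C k -> C (k + 1) -> C (k - 1).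
  rewrite /C intrB intrD Z3_sub1 Z3_add21 -addrA => ME Mn.
  have := free_rot k%:~R; have [_ _ /reflected_sym] := orb k.
  have [+ _ _] := orb (k - 1); rewrite /incident !edgeE intrB Z3_sub1 Z3_add21.
  rewrite transverseE [join _ (M (k + 1))]/join Mn ME.
  move: (e k%:~R) (e (k%:~R + 1)) (e (k%:~R + 2)) ME => y z x ME Me h f.
  rewrite (addrC x); apply: (@reflected_basis_inj _ (M k) _ x z y).
  - by rewrite (@perm_free _ _ _ [:: x; y; z]) // perm_cons (perm_catC [:: _]).
  - by rewrite addrC.
  - by rewrite addvC.
  - rewrite (addrC z) (addrC x) (addvC <[z]>%VS) (addvC <[z + x]>%VS).
    by rewrite /join (addvC (M k)).
(* Each step uses two consecutive points, so the induction in both directions from 0 carries a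
   pair. *)
move=> k; suff [] : C k /\ C (k + 1) by [].
elim/int_rect: k => [|n [Cn Cn1]|n [Cn Cn1]].
- by rewrite /C add0r.
- have -> : n.+1%:Z = n%:Z + 1 by rewrite -addn1 PoszD.
  by split=> //; apply: fwd; rewrite // addrK.
- have -> : - n.+1%:Z = - n%:Z - 1 by rewrite -addn1 PoszD opprD.
  by rewrite subrK; split=> //; apply: bwd.
Qed.

(** The edge without its two ends, each of which lies on another edge; avoiding lines rather than
    vertices lets openness follow from [open_off_line]. *)
Definition off_vertices i : set (RP2 R) := points_of (edge B i) `&`
  [set p | ~~ incident p (edge B (i + 1))] `&` [set p | ~~ incident p (edge B (i + 2))].

Lemma open_off_vertices i :
  open (off_vertices i : set (subspace (points_of (edge B i)))).
Proof.
apply/open_subspaceP; exists ([set p | ~~ incident p (edge B (i + 1))] `&`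
  [set p | ~~ incident p (edge B (i + 2))]).
  by apply: openI; exact: open_off_line.
by apply/seteqP; split => p /=; rewrite /off_vertices /=; tauto.
Qed.

(** Avoiding edge i + 1 amounts to a being non-zero, and avoiding edge i + 2 to b being non-zero;
    this is what permits the rescaling. *)
Lemma off_verticesP i p : off_vertices i p <->
  exists a b, [/\ a != 0, b != 0 & rp_space p = <[a *: e i + b *: e (i + 1)%R]>%VS].
Proof.
have f := free_rot i; rewrite /off_vertices /points_of /= /incident !edgeE.
rewrite Z3_add21 -[i + 1 + 1]addrA; split.
  move=> [[]]; have [v ->] := RP2_vline p.
  rewrite -!memvE => /memv_add_linesP[a [b ->]] n1 n2.
  exists a, b; split=> //.
    apply: contraNneq n1 => ->; apply/memv_add_linesP; exists b, 0.
    by rewrite !scale0r add0r addr0.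
  apply: contraNneq n2 => ->; apply/memv_add_linesP; exists 0, a.
  by rewrite !scale0r add0r addr0.
move=> [a [b [a0 b0 ->]]]; rewrite -!memvE; split; first split.
- by rewrite memv_add ?memvZ ?memv_line.
- apply/negP => /memv_add_linesP[c [d /rowP E]].
  have [|_ a0' _] := @free3_eq0 _ _ _ _ (- d) a (b - c) f.
    by apply/rowP => j; have := E j; rewrite !mxE; lra.
  by rewrite a0' eqxx in a0.
- apply/negP => /memv_add_linesP[c [d /rowP E]].
  have [|_ _ b0'] := @free3_eq0 _ _ _ _ (- c) (a - d) b f.
    by apply/rowP => j; have := E j; rewrite !mxE; lra.
  by rewrite b0' eqxx in b0.
Qed.

Lemma midpoint_exists i : exists p, rp_space p = <[e i + e (i + 1)%R]>%VS.
Proof.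
apply: exists_RP2; apply/eqP => E.
have [|] := @free3_eq0 _ _ _ _ 0 1 1 (free_rot i); last by lra.
by rewrite scale0r add0r !scale1r.
Qed.

Lemma off_vertices_nonempty i : off_vertices i !=set0.
Proof.
have [p pE] := midpoint_exists i.
by exists p; apply/off_verticesP; exists 1, 1; rewrite oner_eq0 !scale1r.
Qed.

End RightSphericalBasis.
End Orbits.

(** * Normalisation of generic initial points and closing of the orbit *)

Theorem proposition1p2 (R : realType) (P0 P1 P2 : RP2 R)
    (nP : ~ collinear P0 P1 P2) :
  reflective (right_spherical nP) 3.
Proof.
have [e eP] : {e : 'Z_3 -> 'rV[R]_3 |
    forall i, rp_space (triangle P0 P1 P2 i) = <[e i]>%VS}.
  by have [e eP] := boolp.choice (fun i => RP2_vline (triangle P0 P1 P2 i)); exists e.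
split=> //; exists (off_vertices nP 0), (off_vertices nP 1).
split; try exact: off_vertices_nonempty eP _.
- by split; [move=> p [[]]|exact: open_off_vertices].
- by split; [move=> p [[]]|exact: open_off_vertices].
move=> M0 M1 /(off_verticesP nP eP)[a [b [a0 b0 M0E]]].
move=> /(off_verticesP nP eP)[c [d [c0 d0 M1E]]].
(* Rescaling the e i turns the initial points into e' 0 + e' 1 and e' 1 + e' 2. *)
pose s : 'Z_3 -> R := tnth [tuple a; b; b * d / c].
pose e' i := s i *: e i.
have s0 i : s i != 0.
  rewrite /s (tnth_nth 0); case: i => -[|[|[|n]]] lt_n3 //=.
  by rewrite !mulf_neq0 ?invr_neq0.
have eP' i : rp_space (triangle P0 P1 P2 i) = <[e' i]>%VS by rewrite line_scale.
have {}M0E : rp_space M0 = <[e' 0%R + e' 1%R]>%VS by rewrite M0E add0r.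
have {}M1E : rp_space M1 = <[e' 1%R + e' 2%R]>%VS.
  (* The factor b / c gives [e 1] the coefficient b already imposed by [M0], which dictates the
     third scale b d / c. *)
  rewrite M1E -(@line_scale _ _ (b / c)) ?mulf_neq0 ?invr_neq0 //.
  congr <[_]>%VS; rewrite scalerDr !scalerA divfK // mulrAC; congr (_ *: e _ + _ *: e _).
have [Q QE] : {Q : 'Z_3 -> RP2 R | forall i, rp_space (Q i) = <[e' i + e' (i + 1)%R]>%VS}.
  by have [Q QE] := boolp.choice (midpoint_exists nP eP'); exists Q.
have ME k : rp_space (Q k%:~R) = <[e' k%:~R + e' (k%:~R + 1)%R]>%VS by [].
exists (fun k : int => Q k%:~R); split; last first.
  (* In ['Z_3] the indices 3 and 4 are 0 and 1, so the points themselves recur and not only the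
     line. *)
  by rewrite /periodic; congr (join (Q _) (Q _)); apply: val_inj.
split.
  split; first exact: midpoints_orbit ME.
  - by apply: val_inj; rewrite /= QE M0E add0r.
  - by apply: val_inj; rewrite /= QE M1E.
move=> M [orb M0' M1']; apply/funext => k; apply: val_inj => /=.
by rewrite QE (orbit_midpoints eP' orb) // ?M0' ?M1'.
Qed.
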